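(* Let $X$ be a topological space and $\ell$ a kernel on $X$ satisfying: (Q0) for any $m$ distinct points $\lambda_1,\dots,\lambda_m\in X$, the kernel functions $\ell_{\lambda_1},\dots,\ell_{\lambda_m}$ are linearly independent; (Q1) $\ell:X\times X\to\mathbb{C}$ is continuous; (Q2) if $\{\lambda_i\}\subset X$ satisfies $\|\ell_{\lambda_i}\|\to\infty$, then $\|\ell_{\lambda_i}\|^{-1}\ell(\lambda_i,\mu)\to0$ for every $\mu\in X$; (Q3) every sequence $\{\lambda_i\}\subset X$ either satisfies $\|\ell_{\lambda_i}\|\to\infty$ or has a subsequence converging to a point of $X$. Then the following are equivalent: (i) $\ell$ has the automatic separation property; (ii) for every $n\ge3$ and every sequence $\{\lambda_i\}$ weakly separated by $\ell$ that can be written as $\{\lambda_i\}=\bigcup_{j\ge1}\bigcup_{k=1}^n\{\mu^k_j\}$ with $\|\ell_{\mu^k_j}\|\to\infty$ as $j\to\infty$ for each $1\le k\le n$, there is a subsequence $\{m_j\}$ such that $\bigcup_{j\ge1}\bigcup_{k=1}^n\{\mu^k_{m_j}\}$ is an interpolating sequence for $\mathcal{H}_\ell$.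
   Context: A kernel on $X$ is a positive semi-definite function $\ell:X\times X\to\mathbb{C}$; $\mathcal{H}_\ell$ its reproducing kernel Hilbert space, $\ell_w=\ell(\cdot,w)$, $\|\ell_w\|^2=\ell(w,w)$, $\hat\ell_w=\ell_w/\|\ell_w\|$, $d_\ell(z,w)=\sqrt{1-|\langle\hat\ell_z,\hat\ell_w\rangle|^2}$. A sequence $\{\lambda_i\}$ is weakly separated by $\ell$ if $d_\ell(\lambda_i,\lambda_j)\ge\epsilon>0$ for all $i\ne j$; for $n\ge2$ it is $n$-weakly separated by $\ell$ if there is $\epsilon>0$ such that for every $n$-point subset $\{\mu_1,\dots,\mu_n\}$ of it, $\mathrm{dist}(\hat\ell_{\mu_1},\mathrm{span}\{\hat\ell_{\mu_2},\dots,\hat\ell_{\mu_n}\})\ge\epsilon$. $\ell$ has the automatic separation property if every sequence weakly separated by $\ell$ is $n$-weakly separated by $\ell$ for every $n\ge3$. A sequence $\{\lambda_i\}$ is interpolating for $\mathcal{H}_\ell$ if the map $f\mapsto (f(\lambda_i)/\|\ell_{\lambda_i}\|)_i$ maps $\mathcal{H}_\ell$ onto $\ell^2$ (equivalently, $\{\hat\ell_{\lambda_i}\}$ is a Riesz sequence). *)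

(* Defs.v *)
From HB Require Import structures.
From mathcomp Require Import all_boot all_order all_algebra.
From mathcomp Require Import all_classical all_reals all_analysis.
From mathcomp.real_closed Require Import complex.
Export numFieldTopology.Exports.

Set Implicit Arguments.
Unset Strict Implicit.
Unset Printing Implicit Defensive.

Import Order.TTheory GRing.Theory Num.Theory.
Local Open Scope classical_set_scope.
Local Open Scope ring_scope.

(* The complex numbers are modelled as R[i] for R : realType.  For topological
   statements we view R[i] through the alias (R[i])^o, which carries the
   metric topology of the modulus |z| (numFieldTopology). *)

Section KernelDefs.
Variables (R : realType) (X : Type).
Local Notation C := R[i].
Implicit Types (l : X -> X -> C).

Definition cabs (z : C) : R := complex.Re `|z|.

Definition is_kernel l : Prop :=
  forall (n : nat) (p : 'I_n -> X) (a : 'I_n -> C),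
    0 <= \sum_(i < n) \sum_(j < n) (a i)^* * a j * l (p i) (p j).

Definition knorm l (w : X) : R := Num.sqrt (complex.Re (l w w)).

(* <hat l_z, hat l_w> = <l_z, l_w>/(||l_z|| ||l_w||) = l(w,z)/(||l_z|| ||l_w||). *)
Definition kip l (z w : X) : C := l w z / ((knorm l z * knorm l w)%:C)%C.

Definition kdist l (z w : X) : R := Num.sqrt (1 - cabs (kip l z w) ^+ 2).

(* || sum_{i in I} a_i hat l_{p_i} ||^2 in H_l, computed from the kernel. *)
Definition comb_sqnorm l (I : finType) (p : I -> X) (a : I -> C) : R :=
  complex.Re (\sum_(i : I) \sum_(j : I) a i * (a j)^* * kip l (p i) (p j)).

Definition comb_norm l (I : finType) (p : I -> X) (a : I -> C) : R :=
  Num.sqrt (comb_sqnorm l p a).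

Definition dist_span l (x : X) (m : nat) (q : 'I_m -> X) : R :=
  inf (range (fun b : 'I_m -> C =>
    comb_norm l (fun o : option 'I_m => if o is Some k then q k else x)
                (fun o : option 'I_m => if o is Some k then - b k else 1))).

Definition weakly_separated l (lam : nat -> X) : Prop :=
  exists2 eps : R, 0 < eps &
    forall i j : nat, i <> j -> eps <= kdist l (lam i) (lam j).

Definition n_weakly_separated l (n : nat) (lam : nat -> X) : Prop :=
  exists2 eps : R, 0 < eps &
    forall (x : X) (q : 'I_n.-1 -> X),
      injective q -> (forall k, q k <> x) ->
      (exists i, lam i = x) -> (forall k, exists i, lam i = q k) ->
      eps <= dist_span l x q.

Definition automatic_separation l : Prop :=
  forall lam : nat -> X, weakly_separated l lam ->
    forall n : nat, (3 <= n)%N -> n_weakly_separated l n lam.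

(* A set S of points is interpolating for H_l iff {hat l_x : x in S} is a
   Riesz sequence. *)
Definition interpolating l (S : set X) : Prop :=
  exists c : R, exists c' : R, 0 < c /\ 0 < c' /\
    forall (m : nat) (p : 'I_m -> X) (a : 'I_m -> C),
      injective p -> (forall k, S (p k)) ->
      c * (\sum_(k < m) cabs (a k) ^+ 2) <= comb_sqnorm l p a
      /\ comb_sqnorm l p a <= c' * (\sum_(k < m) cabs (a k) ^+ 2).

End KernelDefs.

Section Hyp.
Variables (R : realType) (X : topologicalType).
Local Notation C := R[i].
Implicit Types (l : X -> X -> C).

Definition Q0 l : Prop :=
  forall (m : nat) (p : 'I_m -> X), injective p ->
    forall a : 'I_m -> C,
      (forall z : X, \sum_(k < m) a k * l z (p k) = 0) -> forall k, a k = 0.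

Definition Q1 l : Prop :=
  continuous (fun xy : X * X => (l xy.1 xy.2 : (R[i])^o)).

Definition Q2 l : Prop :=
  forall lam : nat -> X,
    (fun i => knorm l (lam i)) @ \oo --> +oo ->
    forall mu : X,
      (fun i => (((knorm l (lam i))^-1)%:C%C * l (lam i) mu : (R[i])^o)) @ \oo
        --> (0 : (R[i])^o).

Definition Q3 l : Prop :=
  forall lam : nat -> X,
    (fun i => knorm l (lam i)) @ \oo --> +oo
    \/ exists phi : nat -> nat, {homo phi : a b / (a < b)%N} /\
         exists x : X, (fun j => lam (phi j)) @ \oo --> x.

Definition cond_ii l : Prop :=
  forall n : nat, (3 <= n)%N ->
  forall lam : nat -> X, weakly_separated l lam ->
  forall mu : 'I_n -> nat -> X,
    (forall x : X, (exists i, lam i = x) <-> (exists k j, mu k j = x)) ->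
    (forall k, (fun j => knorm l (mu k j)) @ \oo --> +oo) ->
    exists m : nat -> nat, {homo m : a b / (a < b)%N} /\
      interpolating l [set x | exists k j, mu k (m j) = x].

End Hyp.

(* Main.v *)
(* Everything is read off the Gram matrices of the normalized kernel functions.
   By continuity and (Q3), the norms of a weakly separated sequence tend to
   infinity, so by (Q2) its normalized kernel functions tend weakly to zero.

   (i) => (ii): n-weak separation bounds the Gram matrices of the blocks
   [{mu^1_j, ..., mu^n_j}] from below.  Along a sufficiently sparse subsequence
   distinct blocks are almost orthogonal, with geometrically decaying inner
   products, and the union of the blocks is a Riesz sequence.

   (ii) => (i): (ii) forces a uniform lower bound for the Gram matrices of
   n-tuples whose indices are all large.  A fixed finite set of points is
   linearly independent by (Q0) and almost orthogonal to points of large index,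
   so adjoining it keeps a lower bound.  A tuple with a small index is handled
   by moving that index to the fixed set: there are only finitely many small
   indices, and induction on the number of free points gives a uniform
   bound. *)
Require Import Defs.
From HB Require Import structures.
From mathcomp Require Import all_boot all_order all_algebra.
From mathcomp Require Import all_classical all_reals all_analysis.
From mathcomp.real_closed Require Import complex.
From mathcomp Require Import ring lra.

Set Implicit Arguments.
Unset Strict Implicit.
Unset Printing Implicit Defensive.

Import Order.TTheory GRing.Theory Num.Theory.
Local Open Scope classical_set_scope.
Local Open Scope ring_scope.

(** * Modulus and real part of complex numbers *)

Section ComplexModulus.
Variable R : realType.
Local Notation C := R[i].
Implicit Types (z w : C) (r : R).

Lemma normc_cabsE z : `|z| = (cabs z)%:C%C.
Proof. by rewrite /cabs normc_def. Qed.

Lemma cabs_ge0 z : 0 <= cabs z.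
Proof. by rewrite -ler0c -normc_cabsE normr_ge0. Qed.

Lemma cabsM z w : cabs (z * w) = cabs z * cabs w.
Proof. by apply: (@complexI R); rewrite rmorphM /= -!normc_cabsE normrM. Qed.

Lemma cabsD z w : cabs (z + w) <= cabs z + cabs w.
Proof. by rewrite -lecR rmorphD /= -!normc_cabsE ler_normD. Qed.

Lemma cabsN z : cabs (- z) = cabs z.
Proof. by rewrite /cabs normrN. Qed.

Lemma cabsJ z : cabs z^* = cabs z.
Proof. by rewrite /cabs norm_conjC. Qed.

Lemma cabs0 : cabs (0 : C) = 0.
Proof. by rewrite /cabs normr0. Qed.

Lemma cabs1 : cabs (1 : C) = 1.
Proof. by rewrite /cabs normr1. Qed.

Lemma cabs_eq0 z : (cabs z == 0) = (z == 0).
Proof. by rewrite -(inj_eq (@complexI R)) -normc_cabsE normr_eq0. Qed.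

Lemma cabs_real r : cabs r%:C%C = `|r|.
Proof. by rewrite /cabs normc_def /= expr0n addr0 sqrtr_sqr. Qed.

Lemma cabsV z : cabs z^-1 = (cabs z)^-1.
Proof. by apply: (@complexI R); rewrite fmorphV /= -!normc_cabsE normfV. Qed.

Lemma complexReD z w : complex.Re (z + w) = complex.Re z + complex.Re w.
Proof. by case: z w => [? ?] [? ?]. Qed.

Lemma complexRe_sum (I : Type) (s : seq I) (P : pred I) (F : I -> C) :
  complex.Re (\sum_(i <- s | P i) F i) = \sum_(i <- s | P i) complex.Re (F i).
Proof. by apply: (big_morph (@complex.Re R)) => //; exact: complexReD. Qed.

Lemma complexReMr r z : complex.Re (r%:C%C * z) = r * complex.Re z.
Proof. by case: z => a b /=; rewrite mul0r subr0. Qed.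

Lemma norm_Re_le z : `|complex.Re z| <= cabs z.
Proof. by rewrite -lecR -normc_cabsE normc_ge_Re. Qed.

Lemma cabs_dist z w : `|cabs z - cabs w| <= cabs (z - w).
Proof.
have h (a b : C) : cabs a <= cabs b + cabs (a - b).
  by have := cabsD b (a - b); rewrite addrCA subrr addr0.
have := h z w; have := h w z.
by rewrite -(cabsN (w - z)) opprB ler_norml => *; lra.
Qed.

Lemma mulcJ z : z * z^* = ((cabs z) ^+ 2)%:C%C.
Proof. by rewrite -normCK normc_cabsE rmorphXn. Qed.

Lemma conjC_realc r : (r%:C%C : C)^* = r%:C%C.
Proof. by rewrite /Num.conj /= oppr0. Qed.

(* [R[i]] carries the topology of the modulus, whose radii are positive
   complex numbers: this brings convergence back to real radii. *)
Lemma cvg_cabs (u : nat -> C) z :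
  ((fun i => (u i : (R[i])^o)) @ \oo --> (z : (R[i])^o)) ->
  forall e, 0 < e -> exists N, forall i, (N <= i)%N -> cabs (u i - z) < e.
Proof.
move=> /cvgrPdist_lt h e e0.
have /h [N _ hN] : 0 < e%:C%C :> C by rewrite ltcR.
exists N => i /hN /=; rewrite -normrN opprB.
by rewrite normc_cabsE ltcR.
Qed.

End ComplexModulus.

Lemma finite_uniform_rank (T : eqType) (s : seq T) (P : T -> nat -> Prop) :
  (forall x, x \in s -> exists N, forall j, (N <= j)%N -> P x j) ->
  exists N, forall j, (N <= j)%N -> forall x, x \in s -> P x j.
Proof.
elim: s => [|y s IH] h; first by exists 0%N.
have [|N1 h1] := IH; first by move=> x xs; apply: h; rewrite inE xs orbT.
have [N2 h2] := h y (mem_head _ _).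
exists (maxn N1 N2) => j; rewrite geq_max => /andP[j1 j2] x; rewrite inE.
by case/predU1P => [->|xs]; [exact: h2|exact: h1].
Qed.

Lemma sumr_const_seq (V : nmodType) (T : Type) (s : seq T) (v : V) :
  \sum_(x <- s) v = v *+ size s.
Proof. by rewrite big_const_seq count_predT iter_addr_0. Qed.

Lemma ler_sum_mem (R : numDomainType) (T : eqType) (s : seq T) (F G : T -> R) :
  {in s, forall x, F x <= G x} -> \sum_(x <- s) F x <= \sum_(x <- s) G x.
Proof. by move=> h; rewrite !big_seq; apply: ler_sum => x /h. Qed.

(** * The Hermitian form of a kernel and the Cauchy-Schwarz inequality *)

Section KernelForm.
Variables (R : realType) (X : eqType).
Local Notation C := R[i].
Implicit Types (K : X -> X -> C) (s t : seq X) (a b : X -> C).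

(* The inner product of [\sum_x a x K_x] and [\sum_y b y K_y] in the Hilbert
   space of [K]. *)
Definition kform K s a b : C :=
  \sum_(x <- s) \sum_(y <- s) a x * (b y)^* * K y x.

Definition ksq K s a : R := complex.Re (kform K s a a).

Lemma ksqE K s a :
  ksq K s a = \sum_(x <- s) \sum_(y <- s) complex.Re (a x * (a y)^* * K y x).
Proof.
rewrite /ksq /kform complexRe_sum; apply: eq_bigr => x _.
by rewrite complexRe_sum.
Qed.

Lemma kform_ge0 K s a : is_kernel K -> 0 <= kform K s a a.
Proof.
move=> kK; rewrite /kform exchange_big /= big_tnth.
under eq_bigr do rewrite big_tnth.
have := kK _ (tnth (in_tuple s)) (fun i => a (tnth (in_tuple s) i)).
congr (_ <= _); apply: eq_bigr => i _; apply: eq_bigr => j _.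
by rewrite [_^* * _]mulrC.
Qed.

Lemma ksq_ge0 K s a : is_kernel K -> 0 <= ksq K s a.
Proof. by move=> kK; have := kform_ge0 s a kK; rewrite lecE => /andP[]. Qed.

Lemma kformE K s a : is_kernel K -> kform K s a a = (ksq K s a)%:C%C.
Proof.
move=> kK; have := kform_ge0 s a kK; rewrite lecE /ksq => /andP[/eqP].
by case: (kform _ _ _ _) => u v /= ->.
Qed.

Lemma eq_ksq K s a b : {in s, a =1 b} -> ksq K s a = ksq K s b.
Proof.
move=> ab; rewrite !ksqE; apply: eq_big_seq => x xs; apply: eq_big_seq => y ys.
by rewrite !ab.
Qed.

Lemma perm_ksq K s t a : perm_eq s t -> ksq K s a = ksq K t a.
Proof.
move=> st; rewrite !ksqE (perm_big _ st) /=; apply: eq_bigr => x _.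
by rewrite (perm_big _ st).
Qed.

Lemma kformDZ K s a b (c d : C) :
  kform K s (fun x => c * a x + d * b x) (fun x => c * a x + d * b x) =
  c * c^* * kform K s a a + c * d^* * kform K s a b + d * c^* * kform K s b a
  + d * d^* * kform K s b b.
Proof.
rewrite /kform !mulr_sumr -!big_split; apply: eq_bigr => x _ /=.
rewrite !mulr_sumr -!big_split; apply: eq_bigr => y _ /=.
by rewrite rmorphD !rmorphM; ring.
Qed.

Lemma ksqZ K s a (c : C) :
  ksq K s (fun x => c * a x) = cabs c ^+ 2 * ksq K s a.
Proof.
rewrite /ksq -complexReMr -mulcJ; congr complex.Re.
rewrite /kform mulr_sumr; apply: eq_bigr => x _; rewrite mulr_sumr.
by apply: eq_bigr => y _; rewrite rmorphM; ring.
Qed.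

Lemma kernel_diag_ge0 K x : is_kernel K -> 0 <= K x x.
Proof.
move=> kK; have := kform_ge0 [:: x] (fun=> 1) kK.
by rewrite /kform !big_seq1 rmorph1 !mul1r.
Qed.

(** Positivity makes the form on two points real when the coefficients are [1] and [c]. Taking
    [c = 1] compares imaginary parts, [c = i] real parts. *)
Lemma kernel_herm K x y : is_kernel K -> K y x = (K x y)^*.
Proof.
move=> kK; have Im0 z : 0 <= K z z -> complex.Im (K z z) = 0.
  by move=> ?; apply: ger0_Im.
have [->|xy] := eqVneq x y.
  move: (Im0 y (kernel_diag_ge0 y kK)); case: (K y y) => u v /= ->.
  by rewrite /Num.conj /= oppr0.
have h (c : C) := kform_ge0 [:: x; y] (fun u => if u == x then 1 else c) kK.
have {}h (c : C) : complex.Im (c * K x y + c^* * K y x) = 0.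
  have /ger0_Im := h c; rewrite /kform !(big_cons, big_nil) !addr0 eqxx.
  rewrite eq_sym (negPf xy).
  rewrite rmorph1 !mul1r mulr1 mulcJ.
  move: (Im0 x (kernel_diag_ge0 x kK)) (Im0 y (kernel_diag_ge0 y kK)).
  case: (K x x) (K y y) => u1 v1 [u2 v2] /= -> ->.
  case: (c * K x y) (c^* * K y x) => [a1 b1] [a2 b2] /= hh.
  by rewrite -hh; ring.
have := h 1; have := h (Complex 0 1).
case: (K x y) (K y x) => [p q] [p' q'].
rewrite /Num.conj /= => h1 h2; congr Complex; lra.
Qed.

Lemma kform_conj K s a b : is_kernel K -> kform K s b a = (kform K s a b)^*.
Proof.
move=> kK; rewrite /kform rmorph_sum exchange_big /=; apply: eq_bigr => x _.
rewrite rmorph_sum; apply: eq_bigr => y _.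
rewrite !rmorphM /= conjCK -(kernel_herm y x kK); ring.
Qed.

(* The additional [+ 1] in this form of the Cauchy-Schwarz inequality
   removes the case of a degenerate [b]. *)
Lemma kform_cs K s a b : is_kernel K ->
  cabs (kform K s a b) ^+ 2 <= (ksq K s b + 1) * ksq K s a.
Proof.
move=> kK; set B := ksq K s b; set A := ksq K s a; set z := kform K s a b.
have B0 : 0 <= B := ksq_ge0 s b kK.
(* Positivity is tested on [a - r z b]. The optimal [r] would be [B^-1]; since [r * B = 1 - r], this
   choice still yields [A >= r * cabs z ^+ 2]. *)
pose r : R := (B + 1)^-1.
have := kform_ge0 s (fun x => 1 * a x + (- r%:C%C * z) * b x) kK.
rewrite kformDZ (kform_conj s a b kK) !kformE // -/A -/B -/z.
rewrite rmorphM rmorphN /= (conjC_realc r) rmorph1 !mul1r mulr1.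
have := sqr_ge0 (cabs z); have := mulcJ z.
move: (cabs z ^+ 2) => w zz w0.
rewrite [X in _ <= X]
  (_ : _ = (A - r * w - r * w + r * r * w * B)%:C%C); last first.
  by rewrite !(rmorphD, rmorphN, rmorphM) /= -!zz; ring.
rewrite ler0c => h.
have rB : r * (B + 1) = 1 by rewrite mulVf // gt_eqF //; lra.
have r0 : 0 < r by rewrite invr_gt0; lra.
rewrite -(ler_pM2l r0) mulrA rB mul1r.
have -> : A = A - r * w - r * w + r * r * w * B
    + (2 * r * w - r * (r * (B + 1) - r) * w) by ring.
rewrite rB; have : 0 <= r * r * w by rewrite !mulr_ge0 // ltW.
nra.
Qed.

End KernelForm.

(** * Boundedness of point evaluations *)

Section KernelEvaluation.
Variables (R : realType) (X : eqType) (K : X -> X -> R[i]).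
Hypothesis kK : is_kernel K.

(** By the reproducing property the sum is the inner product of [\sum_x a x K_x] with [K_z], so
    [kform_cs] applies with the indicator of [z]. A point [z] outside [s] is first adjoined with
    coefficient zero. *)
Lemma kernel_eval_cs (s : seq X) (a : X -> R[i]) z : uniq s ->
  cabs (\sum_(x <- s) a x * K z x) ^+ 2 <=
  (complex.Re (K z z) + 1) * ksq K s a.
Proof.
wlog zs : s a / z \in s => [hw us|us].
  have [/hw|zs] := boolP (z \in s); first exact.
  pose a' x := if x == z then 0 else a x.
  have aE : {in s, a' =1 a}.
    by move=> x xs; rewrite /a'; case: eqP => // xz; rewrite -xz xs in zs.
  have := hw (z :: s) a' (mem_head _ _); rewrite /= zs us => /(_ isT).
  rewrite big_cons {1}/a' eqxx mul0r add0r.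
  have -> : \sum_(x <- s) a' x * K z x = \sum_(x <- s) a x * K z x.
    by apply: eq_big_seq => x xs; rewrite aE.
  suff -> : ksq K (z :: s) a' = ksq K s a by [].
  rewrite -(eq_ksq K aE) !ksqE big_cons big1 => [|y _]; last first.
    by rewrite /a' eqxx !mul0r.
  rewrite add0r; apply: eq_bigr => x _; rewrite big_cons.
  by rewrite [a' z]/a' eqxx rmorph0 mulr0 mul0r add0r.
pose b x : R[i] := (x == z)%:R.
have hb (F : X -> R[i]) : \sum_(y <- s) (b y)^* * F y = F z.
  rewrite (bigD1_seq z) //= /b eqxx rmorph1 mul1r big1 ?addr0 // => y /negPf ->.
  by rewrite rmorph0 mul0r.
have hb' (F : X -> R[i]) : \sum_(y <- s) b y * F y = F z.
  rewrite -[RHS]hb; apply: eq_bigr => y _; congr (_ * _).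
  by rewrite /b; case: eqP => _; rewrite ?rmorph1 ?rmorph0.
have := kform_cs s a b kK.
rewrite {2}/ksq /kform.
under eq_bigr do (under eq_bigr do rewrite -mulrA mulrCA; rewrite hb).
under [X in _ <= (complex.Re X + 1) * _]eq_bigr do
  (under eq_bigr do rewrite -mulrA mulrCA; rewrite hb).
by rewrite hb'.
Qed.

Lemma kernel_cs x z :
  cabs (K z x) ^+ 2 <= (complex.Re (K z z) + 1) * complex.Re (K x x).
Proof.
have := @kernel_eval_cs [:: x] (fun=> 1) z isT.
by rewrite ksqE !big_seq1 rmorph1 !mul1r.
Qed.

End KernelEvaluation.

(** * The normalized kernel and its Gram matrices *)

Section NormalizedKernel.
Variables (R : realType) (X : topologicalType) (l : X -> X -> R[i]).
Local Notation C := R[i].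
Implicit Types (s t : seq X) (a b : X -> C).

(** [kip] swaps its arguments, being an inner product. Swapping them back gives a kernel with the
    evaluation point first, to which all results on [kform] apply. *)
Definition khat (y x : X) : C := kip l x y.

Lemma khatE y x :
  khat y x = ((knorm l x)^-1)%:C%C * ((knorm l y)^-1)%:C%C * l y x.
Proof. by rewrite /khat /kip -rmorphM -invfM fmorphV mulrC. Qed.

Lemma comb_sqnorm_ksq (I : finType) (p : I -> X) (b : X -> C) :
  comb_sqnorm l p (b \o p) = ksq khat (codom p) b.
Proof.
rewrite /comb_sqnorm /ksq /kform big_image /=; congr complex.Re.
by apply: eq_bigr => i _; rewrite big_image.
Qed.

(** Moves coefficients from indices to points, so that lists of points can be concatenated and
    permuted. *)
Lemma injective_factor (I : finType) (p : I -> X) (a : I -> C) :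
  injective p -> exists b, a = b \o p.
Proof.
move=> pI; exists (fun x => \sum_(i | p i == x) a i); apply/funext => i /=.
by rewrite (eq_bigl (pred1 i)) ?big_pred1_eq // => j; rewrite (inj_eq pI).
Qed.

(** For a nonempty duplicate-free [s]: the least eigenvalue of the Gram matrix of the normalized
    kernel functions is at least [e]. *)
Definition riesz_lb (e : R) s : Prop :=
  forall a, e * \sum_(x <- s) cabs (a x) ^+ 2 <= ksq khat s a.

Lemma riesz_lb_le e e' s : e' <= e -> riesz_lb e s -> riesz_lb e' s.
Proof.
move=> ee h a; apply: le_trans (h a); apply: ler_wpM2r => //.
by apply: sumr_ge0 => x _; rewrite sqr_ge0.
Qed.

Lemma riesz_lb_perm e s t : perm_eq s t -> riesz_lb e s -> riesz_lb e t.
Proof. by move=> st h a; rewrite -(perm_big _ st) -(perm_ksq _ _ st) h. Qed.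

(** Extending the coefficients by zero on [t], which is disjoint from [s], changes neither side. *)
Lemma riesz_lb_catl e s t : uniq (s ++ t) -> riesz_lb e (s ++ t) ->
  riesz_lb e s.
Proof.
rewrite cat_uniq => /and3P[_ /hasPn st _] h a.
pose a' x := if x \in s then a x else 0.
have as' : {in s, a' =1 a} by move=> x xs; rewrite /a' xs.
have at' : {in t, a' =1 fun=> 0} by move=> x /st /negPf xs; rewrite /a' xs.
have t0 (V : nmodType) (F : C -> X -> V) :
    (forall x, F 0 x = 0) -> \sum_(x <- t) F (a' x) x = 0.
  by move=> F0; rewrite big_seq big1 // => x /at' ->.
have := h a'; rewrite -(eq_ksq _ as') !ksqE !big_cat /=.
rewrite (t0 R (fun c _ => cabs c ^+ 2)) ?cabs0 ?expr0n // addr0.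
rewrite (t0 R (fun c x => \sum_(y <- s ++ t)
  complex.Re (c * (a' y)^* * khat y x))) => [|x]; last first.
  by rewrite big1 // => y _; rewrite !mul0r.
rewrite addr0 (eq_big_seq (fun x => cabs (a x) ^+ 2)) => [|x /as' -> //].
move=> /le_trans; apply; rewrite le_eqVlt; apply/orP; left; apply/eqP.
apply: eq_bigr => x _; rewrite big_cat /=.
rewrite (t0 R (fun c y => complex.Re (a' x * c^* * khat y x))) ?addr0 // => y.
by rewrite rmorph0 mulr0 mul0r.
Qed.

Hypotheses (kl : is_kernel l) (q0 : Q0 l).

(** If the norm vanished, Cauchy-Schwarz would make [l_x] the zero function, against (Q0) for one
    point. *)
Lemma knorm_gt0 x : 0 < knorm l x.
Proof.
rewrite sqrtr_gt0 ltNge; apply/negP => le0.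
have lz z : l z x = 0.
  apply/eqP; rewrite -cabs_eq0 -sqrf_eq0 eq_le sqr_ge0 andbT.
  apply: le_trans (kernel_cs kl x z) _; apply: mulr_ge0_le0 => //.
  have := kernel_diag_ge0 z kl; rewrite lecE => /andP[_ /=]; lra.
have xI : injective (fun _ : 'I_1 => x) by move=> i j _; rewrite !ord1.
have /eqP := q0 xI (a := fun=> 1) (fun z => etrans (big_ord1 _ _)
  (etrans (mul1r _) (lz z))) ord0.
by rewrite oner_eq0.
Qed.

Lemma sqr_knorm x : (knorm l x ^+ 2)%:C%C = l x x.
Proof.
have := kernel_diag_ge0 x kl; rewrite lecE => /andP[/eqP /= i0 /= r0].
by rewrite sqr_sqrtr //; case: (l x x) i0 => u v /= ->.
Qed.

Lemma khat_diag x : khat x x = 1.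
Proof.
have /lt0r_neq0 n0 := knorm_gt0 x.
rewrite khatE -sqr_knorm -!rmorphM.
by rewrite (_ : _ * _ * _ = 1) ?rmorph1 //; field.
Qed.

Lemma khat_kernel : is_kernel khat.
Proof.
move=> n p a.
have := kl p (fun i => a i * ((knorm l (p i))^-1)%:C%C).
congr (_ <= _); apply: eq_bigr => i _; apply: eq_bigr => j _.
by rewrite khatE rmorphM /= conjC_realc; ring.
Qed.

Lemma cabs_khat_sym x y : cabs (khat y x) = cabs (khat x y).
Proof. by rewrite (kernel_herm x y khat_kernel) cabsJ. Qed.

Lemma cabs_khat_le2 x y : cabs (khat y x) <= 2.
Proof.
have := kernel_cs khat_kernel x y; rewrite !khat_diag /=.
have := cabs_ge0 (khat y x); nra.
Qed.

Lemma khat_span_free s (c : X -> C) : uniq s ->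
  (forall z, \sum_(x <- s) c x * khat z x = 0) -> {in s, forall x, c x = 0}.
Proof.
move=> us h x xs.
pose p := tnth (in_tuple s).
have pI : injective p by apply/tuple_uniqP.
have [i xi] : exists i, x = p i by apply/tnthP.
have := @q0 (size s) p pI (fun i => c (p i) * ((knorm l (p i))^-1)%:C%C) _ i.
rewrite -xi => h0; have {h0} : c x * ((knorm l x)^-1)%:C%C = 0.
  apply: h0 => z; have := h z; rewrite big_tnth.
  move=> /(congr1 (fun w => (knorm l z)%:C%C * w)).
  rewrite mulr0 mulr_sumr => E.
  rewrite -[RHS]E; apply: eq_bigr => k _; rewrite khatE -/p.
  have nz : (knorm l z)%:C%C * ((knorm l z)^-1)%:C%C = 1 :> C.
    by rewrite -rmorphM divff ?rmorph1 // lt0r_neq0 // knorm_gt0.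
  rewrite [RHS](_ : _ = c (p k) * ((knorm l (p k))^-1)%:C%C *
    ((knorm l z)%:C%C * ((knorm l z)^-1)%:C%C) * l z (p k)); last by ring.
  by rewrite nz mulr1.
move=> /eqP; rewrite mulf_eq0 => /orP[/eqP //|].
by rewrite fmorph_eq0 invr_eq0 gt_eqF // knorm_gt0.
Qed.

(** A conjugated column of the inverse Gram matrix represents the coordinate functional at [x]. *)
Lemma kform_dual s x : uniq s -> x \in s ->
  exists b, forall a, kform khat s a b = a x.
Proof.
move=> us xs.
pose p := tnth (in_tuple s).
have pI : injective p by apply/tuple_uniqP.
have [i xi] : exists i, x = p i by apply/tnthP.
pose G := \matrix_(i, j) khat (p j) (p i).
have uG : G \in unitmx.
  (* A null vector of [G] has norm zero; by [kernel_eval_cs] its combination vanishes at every [z],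
     and (Q0) kills its coefficients. *)
  rewrite -row_free_unit -kermx_eq0; apply/eqP/eqP/rowV0P => u /sub_kermxP uG.
  have [c cE] := injective_factor (u 0) pI.
  have cE' j : u 0 j = c (p j) by rewrite cE.
  have row0 j : \sum_(k <- s) c k * khat (p j) k = 0.
    rewrite big_tnth -/p; have /matrixP/(_ 0 j) := uG; rewrite !mxE => E.
    by rewrite -[RHS]E; apply: eq_bigr => k _; rewrite !mxE cE'.
  have sq0 : ksq khat s c = 0.
    rewrite /ksq /kform exchange_big /= big_tnth big1 // => j _.
    under eq_bigr do rewrite -mulrA mulrCA.
    by rewrite -mulr_sumr row0 mulr0.
  apply/rowP => j; rewrite !mxE cE'.
  apply: (khat_span_free us _ (mem_tnth j (in_tuple s))) => z; apply/eqP.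
  rewrite -cabs_eq0 -sqrf_eq0 eq_le sqr_ge0 andbT.
  by apply: le_trans (kernel_eval_cs khat_kernel c z us) _; rewrite sq0 mulr0.
pose c := invmx G *m delta_mx i (0 : 'I_1).
have [b bE] := injective_factor (fun j => (c j 0)^*) pI.
exists b => a; rewrite /kform big_tnth -/p.
have Gc : G *m c = delta_mx i 0 by rewrite mulKVmx.
under eq_bigr => k _.
  rewrite (_ : \sum_(y <- s) _ = a (p k) * (k == i)%:R).
    over.
  have /matrixP/(_ k 0) := Gc; rewrite mxE [RHS]mxE eqxx andbT => <-.
  rewrite mulr_sumr big_tnth; apply: eq_bigr => j _; rewrite [G _ _]mxE -/p.
  have -> : b (p j) = (c j 0)^* by rewrite -[LHS]/((b \o p) j) -bE.
  by rewrite conjCK; ring.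
rewrite (bigD1 i) //= eqxx mulr1 big1 ?addr0 -?xi // => k /negPf ->.
by rewrite mulr0.
Qed.

(** Each coefficient is an inner product with a dual vector, so Cauchy-Schwarz bounds its square by
    a multiple of [ksq]; these bounds add up over [s]. *)
Lemma riesz_lb_finite s : uniq s -> exists2 e, 0 < e & riesz_lb e s.
Proof.
move=> us.
have [D D0 hD] : exists2 D, 0 <= D & forall a,
    \sum_(x <- s) cabs (a x) ^+ 2 <= D * ksq khat s a.
  have : {subset s <= s} by [].
  (* The induction shortens only the list summed over; the Gram form stays on the whole of [s]. *)
  elim: {1 3}s => [_|x t IH ts].
    by exists 0 => // a; rewrite big_nil mul0r.
  have [|D D0 hD] := IH; first by move=> y yt; apply: ts; rewrite inE yt orbT.
  have [b hb] := kform_dual us (ts _ (mem_head _ _)).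
  have B0 := ksq_ge0 s b khat_kernel.
  exists (ksq khat s b + 1 + D) => [|a]; first by lra.
  rewrite big_cons [leRHS]mulrDl; apply: lerD => //.
  by rewrite -[a x]hb; apply: kform_cs khat_kernel.
exists (D + 1)^-1 => [|a]; first by rewrite invr_gt0; lra.
rewrite ler_pdivrMl; last by lra.
apply: le_trans (hD a) _; apply: ler_wpM2r; last by lra.
exact: ksq_ge0 khat_kernel.
Qed.

End NormalizedKernel.

Lemma codom_tnth (T : Type) (s : seq T) : codom (tnth (in_tuple s)) = s.
Proof. exact: map_tnth_enum. Qed.

Lemma cvgy_subseq (R : realType) (f : nat -> R) (g : nat -> nat) :
  (forall j, (j <= g j)%N) -> f i @[i --> \oo] --> +oo ->
  f (g j) @[j --> \oo] --> +oo.
Proof.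
move=> gj /cvgryPge h; apply/cvgryPge => A; have [N _ hN] := h A.
by exists N => // j Nj; apply: hN => /=; apply: leq_trans (gj j).
Qed.

Lemma leq_homo_nat (m : nat -> nat) : {homo m : a b / (a < b)%N} ->
  forall j, (j <= m j)%N.
Proof.
by move=> hm; elim=> // j IH; apply: leq_ltn_trans IH (hm _ _ (ltnSn j)).
Qed.

(** Serves to list, each once, the indices met by a family of tuples, so that the family becomes a
    single sequence. An unbounded set of naturals is infinite, hence in bijection with [nat]. *)
Lemma unbounded_enum (U : set nat) : (forall N, exists2 i, (N <= i)%N & U i) ->
  exists2 phi : nat -> nat, injective phi &
    forall i, U i <-> exists j, phi j = i.
Proof.
move=> hU.
have infU : infinite_set U.
  move=> /finite_seqP[s Us].
  have [i ltsi si] := hU (\max_(x <- s) x)%N.+1.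
  move: si ltsi; rewrite Us /= => si.
  by rewrite ltnNge (big_rem i) //= leq_maxl.
have : card_eq [set: nat] U.
  rewrite card_eq_le; apply/andP; split; first by apply/infiniteP.
  exact: (subset_card_le (@subsetT _ U)).
move=> /card_set_bijP[phi [phiU phiI phiS]].
exists phi => [i j|i]; first by apply: phiI; rewrite inE.
by split => [/phiS[j _ <-]|[j <-]]; [exists j|exact: phiU].
Qed.

Lemma cabs_form (R : realType) (z w k : R[i]) :
  cabs (z * w^* * k) = cabs z * cabs w * cabs k.
Proof. by rewrite !cabsM cabsJ. Qed.

Lemma ksq_cat (R : realType) (X : eqType) (K : X -> X -> R[i]) s t a :
  ksq K (s ++ t) a = ksq K s a + ksq K t a
    + \sum_(x <- s) \sum_(y <- t) complex.Re (a x * (a y)^* * K y x)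
    + \sum_(x <- t) \sum_(y <- s) complex.Re (a x * (a y)^* * K y x).
Proof.
rewrite !ksqE big_cat /=.
under eq_bigr do rewrite big_cat /=.
under [X in _ + X = _]eq_bigr do rewrite big_cat /=.
by rewrite !big_split /=; ring.
Qed.

(** * Weak separation and almost orthogonality *)

Section Separation.
Variables (R : realType) (X : topologicalType) (l : X -> X -> R[i]).
Local Notation C := R[i].
Local Notation K := (khat l).
Hypotheses (kl : is_kernel l) (q0 : Q0 l) (q1 : Q1 l) (q2 : Q2 l) (q3 : Q3 l).

Lemma weakly_separated_inj lam : weakly_separated l lam -> injective lam.
Proof.
move=> [e e0 h] i j ij; apply/eqP; apply: contraT => /eqP /h.
rewrite /kdist -ij -[kip _ _ _]/(K (lam i) (lam i)) khat_diag // cabs1.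
by rewrite expr1n subrr sqrtr0 leNgt e0.
Qed.

Lemma weakly_separated_sub lam phi : weakly_separated l lam ->
  injective phi -> weakly_separated l (lam \o phi).
Proof.
by move=> [e e0 h] phiI; exists e => // i j ij /=; apply: h => /phiI.
Qed.

Lemma kernel_cvg (u v : nat -> X) x :
  u j @[j --> \oo] --> x -> v j @[j --> \oo] --> x ->
  forall e, 0 < e -> exists N, forall j, (N <= j)%N ->
    cabs (l (u j) (v j) - l x x) < e.
Proof.
move=> ux vx; apply: (@cvg_cabs R (fun j => l (u j) (v j))).
have h := cvg_comp _ _ (cvg_pair ux vx) (@q1 (x, x)).
exact: h.
Qed.

(* Otherwise a subsequence converges to some [x], and by continuity its
   consecutive points become arbitrarily close for [kdist]. *)
Lemma weakly_separated_cvgy lam : weakly_separated l lam ->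
  knorm l (lam i) @[i --> \oo] --> +oo.
Proof.
move=> [e e0 h]; have [//|[phi [phih [x ux]]]] := q3 lam; exfalso.
set u := fun j => lam (phi j) in ux.
have vx : (fun j => u j.+1) @ \oo --> x.
  by move=> A /ux [N _ hN]; exists N => // j Nj; apply: hN => /=; exact: leqW.
set L := knorm l x ^+ 2.
have L0 : 0 < L by rewrite exprn_gt0 // knorm_gt0.
(* Both squared norms and the modulus of the kernel value will lie within [d * L] of [L]. Separation
   then gives [32 * d * (1 - d)^2 * L^2 <= 4 * d * L^2], which is false for [d <= 1/32]. *)
pose d : R := e ^+ 2 / 32.
have d0 : 0 < d by rewrite divr_gt0 ?exprn_gt0.
have dL : 0 < d * L by rewrite mulr_gt0.
have [N1 h1] := kernel_cvg ux ux dL.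
have [N2 h2] := kernel_cvg vx ux dL.
pose j := maxn N1 N2.
have := h1 j (leq_maxl _ _); have := h1 j.+1 (leqW (leq_maxl _ _)).
have := h2 j (leq_maxr _ _).
have : phi j <> phi j.+1.
  by move=> E; have := phih j j.+1 (ltnSn j); rewrite E ltnn.
move=> /h; rewrite -[lam (phi j)]/(u j) -[lam (phi j.+1)]/(u j.+1).
rewrite -!(sqr_knorm kl) -!rmorphB /= -/L !cabs_real /kdist /kip cabsM.
rewrite cabsV cabs_real ger0_norm; last by rewrite mulr_ge0 ?sqrtr_ge0.
move: (knorm_gt0 kl q0 (u j)) (knorm_gt0 kl q0 (u j.+1)).
set A := knorm l (u j); set B := knorm l (u j.+1) => A0 B0.
set w := l _ _ => he hw hB hA.
have {hw} : `|cabs w - L| < d * L.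
  have := cabs_dist w L%:C%C; rewrite (cabs_real L) (gtr0_norm L0).
  by move=> /le_lt_trans; apply.
move: he; rewrite -ler_sqr ?nnegrE ?sqrtr_ge0 ?(ltW e0) // => he.
have w0 := cabs_ge0 w.
move: he hB hA; rewrite /= in w0 *; move: (cabs w) w0 => c c0.
rewrite exprMn exprVn exprMn => he hB hA hc.
have AB0 : 0 < A ^+ 2 * B ^+ 2 by rewrite mulr_gt0 // exprn_gt0.
have {he} : e ^+ 2 <= 1 - c ^+ 2 / (A ^+ 2 * B ^+ 2).
  (* A negative radicand would make [kdist] zero, the default value of the root, against [0 < e]. *)
  have [pos|neg] := leP 0 (1 - c ^+ 2 / (A ^+ 2 * B ^+ 2)).
    by rewrite sqr_sqrtr in he.
  by move: he; rewrite ltr0_sqrtr // expr0n /= leNgt exprn_gt0.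
move: (A ^+ 2) (B ^+ 2) AB0 hA hB => a b ab0.
rewrite !ltr_norml => /andP[ha1 ha2] /andP[hb1 hb2].
move: hc; rewrite ltr_norml => /andP[hc1 hc2].
have eE : e ^+ 2 = 32 * d by rewrite /d; field.
rewrite eE => he.
have q_ge0 : 0 <= c ^+ 2 / (a * b) by rewrite divr_ge0 ?sqr_ge0 ?(ltW ab0).
have d32 : 32 * d <= 1 by lra.
have : (32 * d) * (a * b) <= a * b - c ^+ 2.
  rewrite -[X in X - c ^+ 2]mul1r -[c ^+ 2](divfK (lt0r_neq0 ab0)) -mulrBl.
  by apply: ler_wpM2r => //; apply: ltW.
have ab_le : a * b <= (L + d * L) * (L + d * L).
  by apply: ler_pM; nra.
have ab_ge : (L - d * L) * (L - d * L) <= a * b.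
  by apply: ler_pM; nra.
have c_ge : (L - d * L) * (L - d * L) <= c ^+ 2.
  by rewrite expr2; apply: ler_pM; nra.
have LL : 0 < L * L by rewrite mulr_gt0.
have dLL : 0 < d * (L * L) by rewrite mulr_gt0.
move: ab_le ab_ge c_ge; move: (a * b) (c ^+ 2) => ab cc h3 h4 h5 h6.
have : 32 * (d * ab) <= 4 * (d * (L * L)) by nra.
have : 4^-1 * (d * (L * L)) < d * ab by nra.
lra.
Qed.

Lemma khat_vanish (u : nat -> X) : knorm l (u j) @[j --> \oo] --> +oo ->
  forall y e, 0 < e -> exists N, forall j, (N <= j)%N -> cabs (K (u j) y) <= e.
Proof.
move=> uy y e e0; have n0 := knorm_gt0 kl q0 y.
have [|N hN] := cvg_cabs (@q2 u uy y) (e := e * knorm l y).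
  by rewrite mulr_gt0.
exists N => j /hN; rewrite subr0 => /ltW hj; rewrite khatE -mulrA cabsM.
by rewrite cabs_real gtr0_norm ?invr_gt0 // ler_pdivrMl // [leRHS]mulrC.
Qed.

Lemma interpolating_riesz_lb (S : set X) : interpolating l S ->
  exists2 c, 0 < c & forall s, uniq s -> (forall x, x \in s -> S x) ->
    riesz_lb l c s.
Proof.
move=> [c [c' [c0 [_ h]]]]; exists c => // s us sS b.
have pI : injective (tnth (in_tuple s)) by apply/tuple_uniqP.
have [||+ _] := h _ (tnth (in_tuple s)) (b \o tnth (in_tuple s)) => //.
  by move=> k; apply: sS; exact: mem_tnth.
by rewrite comb_sqnorm_ksq codom_tnth => hs; rewrite big_tnth.
Qed.

(** A cross term is at most [d / 2] times the sum of the two squared coefficients. Together the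
    cross terms cost at most half of the bound coming from [s] and [t] separately. *)
Lemma riesz_lb_cat (e d : R) s t : riesz_lb l e s -> riesz_lb l e t -> 0 <= d ->
  {in s & t, forall x y, cabs (K y x) <= d} ->
  d * (size s + size t)%:R <= e / 2 -> riesz_lb l (e / 2) (s ++ t).
Proof.
move=> hs ht d0 hd de a; rewrite ksq_cat big_cat /=.
set S := \sum_(x <- s) _; set T := \sum_(x <- t) _.
set U := \sum_(x <- s) \sum_(y <- t) _; set V := \sum_(x <- t) \sum_(y <- s) _.
have S0 : 0 <= S by apply: sumr_ge0 => x _; rewrite sqr_ge0.
have T0 : 0 <= T by apply: sumr_ge0 => x _; rewrite sqr_ge0.
have cross x y : x \in s -> y \in t ->
    - (d / 2) * (cabs (a x) ^+ 2 + cabs (a y) ^+ 2) <=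
      complex.Re (a x * (a y)^* * K y x) /\
    - (d / 2) * (cabs (a x) ^+ 2 + cabs (a y) ^+ 2) <=
      complex.Re (a y * (a x)^* * K x y).
  move=> xs yt; have hk := hd _ _ xs yt.
  have := norm_Re_le (a x * (a y)^* * K y x).
  have := norm_Re_le (a y * (a x)^* * K x y).
  rewrite !cabs_form (cabs_khat_sym kl x y) in hk *.
  move: (cabs_ge0 (a x)) (cabs_ge0 (a y)) (cabs_ge0 (K x y)) hk.
  move: (cabs (a x)) (cabs (a y)) (cabs (K x y)) => p q r p0 q0' r0 rd.
  have pqr : p * q * r <= d / 2 * (p ^+ 2 + q ^+ 2).
    apply: (@le_trans _ _ (p * q * d)); first by rewrite ler_wpM2l ?mulr_ge0.
    have : 0 <= (p - q) ^+ 2 by rewrite sqr_ge0.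
    by nra.
  by rewrite !ler_norml [q * p]mulrC => /andP[h1 _] /andP[h2 _]; split; lra.
have sumE : \sum_(x <- s) \sum_(y <- t) (- (d / 2) *
    (cabs (a x) ^+ 2 + cabs (a y) ^+ 2)) =
    - (d / 2) * ((size t)%:R * S + (size s)%:R * T).
  under eq_bigr do rewrite -mulr_sumr big_split /= sumr_const_seq.
  rewrite -mulr_sumr big_split /= sumr_const_seq sumrMnl.
  by rewrite -(mulr_natl S) -(mulr_natl T).
have hU : - (d / 2) * ((size t)%:R * S + (size s)%:R * T) <= U.
  rewrite -sumE; apply: ler_sum_mem => x xs; apply: ler_sum_mem => y yt.
  by have [] := cross x y xs yt.
have hV : - (d / 2) * ((size t)%:R * S + (size s)%:R * T) <= V.
  rewrite -sumE [V]exchange_big; apply: ler_sum_mem => x xs.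
  by apply: ler_sum_mem => y yt; have [] := cross x y xs yt.
have := hs a; have := ht a; rewrite -/S -/T.
move: de; rewrite natrD.
have : 0 <= (size s)%:R :> R by []. have : 0 <= (size t)%:R :> R by [].
move: (size s)%:R (size t)%:R hU hV => n m hU hV m0 n0 de h1 h2.
have : d * (m * S + n * T) <= d * (n + m) * (S + T).
  by rewrite -mulrA ler_wpM2l //; nra.
have : d * (n + m) * (S + T) <= e / 2 * (S + T) by rewrite ler_wpM2r //; lra.
by lra.
Qed.

End Separation.

Lemma finite_uniform_pos (R : realType) (N : nat) (P : nat -> R -> Prop) :
  (forall i e e', e' <= e -> P i e -> P i e') ->
  (forall i, exists2 e, 0 < e & P i e) ->
  exists2 e, 0 < e & forall i, (i < N)%N -> P i e.
Proof.
move=> Pd h; elim: N => [|N [e e0 IH]]; first by exists 1.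
have [e' e'0 he'] := h N.
exists (Num.min e e') => [|i]; first by rewrite lt_min e0.
rewrite ltnS leq_eqVlt => /predU1P[->|/IH].
  by apply: Pd he'; rewrite ge_min lexx orbT.
by apply: Pd; rewrite ge_min lexx.
Qed.

(** * From interpolating subsequences to n-weak separation *)

Section InterpolationToSeparation.
Variables (R : realType) (X : topologicalType) (l : X -> X -> R[i]).
Hypotheses (kl : is_kernel l) (q0 : Q0 l) (q1 : Q1 l) (q2 : Q2 l) (q3 : Q3 l).
Hypothesis cii : cond_ii l.
Variable lam : nat -> X.
Hypothesis wlam : weakly_separated l lam.

(* If the Gram matrices of tuples going off to infinity degenerated, the
   sequence made of those tuples would contradict [cond_ii]. *)
Lemma riesz_lb_far n : exists N, exists2 e, 0 < e &
  forall t, uniq t -> (size t <= n)%N -> all (leq N) t ->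
    riesz_lb l e (map lam t).
Proof.
have lamI := weakly_separated_inj kl q0 wlam.
(* [cond_ii] starts at 3; as [n] only bounds the size of tuples from above, it may be enlarged. *)
wlog n3 : n / (3 <= n)%N => [hw|].
  have [|N [e e0 h]] := hw (maxn n 3); first exact: leq_maxr.
  exists N, e => // t ut tn; apply: h => //; exact: leq_trans (leq_maxl _ _).
apply: contrapT => hN.
have bad j : exists t, [/\ uniq t, (size t <= n)%N, all (leq j) t &
    ~ riesz_lb l j.+1%:R^-1 (map lam t)].
  apply: contrapT => hj; apply: hN; exists j, j.+1%:R^-1 => [|t ut tn tj].
    by rewrite invr_gt0.
  by apply: contrapT => ht; apply: hj; exists t.
have {bad} [s hs] := choice bad.
have us j : uniq (s j) by have [] := hs j.
have sn j : (size (s j) <= n)%N by have [] := hs j.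
have sj j : all (leq j) (s j) by have [] := hs j.
have ns j : ~ riesz_lb l j.+1%:R^-1 (map lam (s j)) by have [] := hs j.
have s_gt0 j : (0 < size (s j))%N.
  rewrite lt0n; apply/negP => /eqP/size0nil s0; apply: (ns j) => a.
  by rewrite s0 ksqE !big_nil mulr0.
(* Tuples shorter than [n] are padded by repeating their first entry, since [cond_ii] takes exactly
   [n] points per block and allows repetitions. *)
pose idx (k : 'I_n) j := nth (head 0%N (s j)) (s j) k.
have idx_in k j : idx k j \in s j.
  rewrite /idx; case: (ltnP k (size (s j))) => [/mem_nth -> //|kj].
  by rewrite nth_default //; case: (s j) (s_gt0 j) => // x t _; exact: mem_head.
have in_idx i j : i \in s j -> exists k, idx k j = i.
  move=> ij; have lt : (index i (s j) < n)%N.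
    by apply: leq_trans (sn j); rewrite index_mem.
  by exists (Ordinal lt); rewrite /idx /= nth_index.
have idx_ge k j : (j <= idx k j)%N by exact: (allP (sj j)).
have [|phi phiI phiE] := @unbounded_enum [set i | exists j, i \in s j].
  by move=> N; exists (head 0%N (s N)); [apply: (allP (sj N))|exists N];
     case: (s N) (s_gt0 N) => // x t _; exact: mem_head.
have [||m [hm /interpolating_riesz_lb [c c0 hc]]] :=
  cii n3 (weakly_separated_sub wlam phiI) (mu := fun k j => lam (idx k j)).
- move=> x; split => [[i <-]|[k [j <-]]].
    have [j] : exists j, phi i \in s j by apply/phiE; exists i.
    by move=> /in_idx[k kj]; exists k, j => /=; rewrite kj.
  have /phiE[i ij] : exists j', idx k j \in s j' by exists j.
  by exists i; rewrite /= ij.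
- move=> k; apply: (cvgy_subseq (f := fun i => knorm l (lam i)) (idx_ge k)).
  exact: weakly_separated_cvgy.
(* The tuple [s (m j)] fails the bound [(m j).+1%:R^-1]. As [j <= m j], this is at most [c], which
   contradicts the interpolation bound. *)
have [j jc] : exists j : nat, j.+1%:R^-1 <= c.
  exists (Num.trunc c^-1); rewrite -[leRHS]invrK lef_pV2 ?posrE ?invr_gt0 //.
  by apply/ltW; rewrite truncnS_gt.
apply: (ns (m j)); apply: riesz_lb_le (hc _ _ _).
- apply: le_trans jc; rewrite lef_pV2 ?posrE ?ltr0n // ler_nat ltnS.
  exact: leq_homo_nat.
- by rewrite map_inj_uniq.
- by move=> x /mapP[i /in_idx[k <-] ->]; exists k, j.
Qed.

Lemma riesz_lb_far_cat F n : uniq F -> exists N, exists2 e, 0 < e &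
  forall t, uniq t -> (size t <= n)%N -> all (leq N) t ->
    riesz_lb l e (map lam (F ++ t)).
Proof.
move=> uF; have lamI := weakly_separated_inj kl q0 wlam.
have [N1 [e1 e10 h1]] := riesz_lb_far n.
have [|e2 e20 h2] := @riesz_lb_finite _ _ _ kl q0 (map lam F).
  by rewrite map_inj_uniq.
pose e := Num.min e1 e2.
have e0 : 0 < e by rewrite lt_min e10.
(* Ensures [d * (size F + n) <= e / 2] as [riesz_lb_cat] requires; the successor keeps the
   denominator positive. *)
pose d := e / 2 / (size F + n).+1%:R.
have d0 : 0 < d by rewrite !divr_gt0.
have [N2 hN2] : exists N, forall j, (N <= j)%N ->
    forall y, y \in map lam F -> cabs (khat l (lam j) y) <= d.
  apply: finite_uniform_rank => y _.
  by apply: khat_vanish => //; exact: weakly_separated_cvgy.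
exists (maxn N1 N2), (e / 2) => [|t ut tn tN]; first by rewrite divr_gt0.
rewrite map_cat; apply: (riesz_lb_cat kl (d := d)).
- by apply: riesz_lb_le h2; rewrite ge_min lexx orbT.
- apply: riesz_lb_le (h1 t ut tn _); first by rewrite ge_min lexx.
  by apply: sub_all tN => i; apply: leq_trans; exact: leq_maxl.
- exact: ltW.
- move=> x _ xF /mapP[i it ->]; apply: hN2 => //.
  by apply: leq_trans (allP tN _ it); exact: leq_maxr.
- rewrite !size_map /d mulrAC ler_pdivrMr ?ltr0n //.
  rewrite ler_wpM2l ?divr_ge0 ?(ltW e0) // ler_nat; apply: leqW.
  by rewrite leq_add2l.
Qed.

(** Induction on the number of free points, for all [F] at once. Either all of [t] lies beyond [N],
    or an index [i < N] of [t] moves into [F] and one free point fewer remains. *)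
Lemma riesz_lb_uniform n F : uniq F -> exists2 e, 0 < e &
  forall t, (size t <= n)%N -> uniq (F ++ t) -> riesz_lb l e (map lam (F ++ t)).
Proof.
have lamI := weakly_separated_inj kl q0 wlam.
elim: n F => [|n IH] F uF.
  have [|e e0 he] := @riesz_lb_finite _ _ _ kl q0 (map lam F).
    by rewrite map_inj_uniq.
  by exists e => // t; rewrite leqn0 => /eqP/size0nil ->; rewrite cats0.
have [N [e1 e10 h1]] := riesz_lb_far_cat n.+1 uF.
have [||e2 e20 h2] := @finite_uniform_pos R N (fun i e => i \notin F ->
    forall t, (size t <= n)%N -> uniq ((i :: F) ++ t) ->
      riesz_lb l e (map lam ((i :: F) ++ t))).
- by move=> i e e' ee h iF t tn ut; apply: riesz_lb_le ee _; exact: h.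
- move=> i; have [iF|iF] := boolP (i \in F); first by exists 1.
  have [|e e0 he] := IH (i :: F); first by rewrite /= iF.
  by exists e.
exists (Num.min e1 e2) => [|t tn ut]; first by rewrite lt_min e10.
have [tN|/allPn[i it]] := boolP (all (leq N) t).
  apply: riesz_lb_le (h1 t _ tn tN); first by rewrite ge_min lexx.
  by move: ut; rewrite cat_uniq => /and3P[].
rewrite -ltnNge => iN.
have pt : perm_eq ((i :: F) ++ rem i t) (F ++ t).
  rewrite perm_sym (perm_trans (y := F ++ i :: rem i t)) //.
    by rewrite perm_cat2l perm_to_rem.
  by rewrite -cat1s perm_catCA.
have iF : i \notin F.
  by move: ut; rewrite cat_uniq => /and3P[_ /hasPn/(_ _ it)].
apply: (riesz_lb_perm (perm_map lam pt)).
apply: riesz_lb_le (h2 i iN iF _ _ _); first by rewrite ge_min lexx orbT.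
  by rewrite size_rem //; move: tn; case: (size t).
by rewrite (perm_uniq pt).
Qed.

(** In the distance to the span the coefficient at [x] is 1, so the sum of squares is at least 1 and
    the squared norm at least [e]. *)
Lemma cond_ii_n_weakly_separated n : (0 < n)%N -> n_weakly_separated l n lam.
Proof.
move=> n0; have lamI := weakly_separated_inj kl q0 wlam.
have [e e0 he] := @riesz_lb_uniform n [::] isT.
exists (Num.sqrt e) => [|x q qI qx [i ix] qlam]; first by rewrite sqrtr_gt0.
apply: lb_le_inf; first by eexists; exists (fun=> 0).
move=> _ [b _ <-]; apply: ler_wsqrtr.
set p := fun o : option _ => _; set a := fun o : option _ => _.
have pI : injective p.
  move=> [k|] [k'|] //=; first by move=> /qI ->.
    by move=> /qx.
  by move=> /esym /qx.
have [c cE] := injective_factor a pI.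
have plam o : exists j, lam j = p o by case: o => [k|]; [exact: qlam|exists i].
have [f fE] := choice plam.
have := he (codom f); rewrite /= size_codom card_option card_ord prednK //.
rewrite -(map_inj_uniq lamI) => /(_ (leqnn _)).
have -> : map lam (codom f) = codom p.
  by rewrite /codom /image_mem -map_comp; apply: eq_map => o /=; rewrite fE.
move=> /(_ _)/(_ c) h; rewrite cE comb_sqnorm_ksq.
apply: le_trans (h _); last by apply/injectiveP.
rewrite -[leLHS]mulr1 ler_wpM2l ?(ltW e0) // big_image /= (bigD1 None) //=.
have -> : c (p None) = 1 by rewrite -[LHS]/((c \o p) None) -cE.
by rewrite cabs1 expr1n lerDl sumr_ge0 // => o _; rewrite sqr_ge0.
Qed.

End InterpolationToSeparation.

(** * From n-weak separation to interpolating subsequences *)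

Lemma sum_by_rank (V : nmodType) (T : eqType) (s : seq T) (J : T -> nat) M
    (F : T -> V) : {in s, forall x, (J x < M)%N} ->
  \sum_(x <- s) F x = \sum_(b < M) \sum_(x <- [seq x <- s | J x == b]) F x.
Proof.
move=> JM; under [RHS]eq_bigr do rewrite big_filter big_mkcond.
rewrite exchange_big /=; apply: eq_big_seq => x /JM xM.
by rewrite -big_mkcond /= (big_pred1 (Ordinal xM)).
Qed.

Lemma geometric_half_le2 (R : realFieldType) M :
  \sum_(b < M) 2^-1 ^+ b <= 2 :> R.
Proof.
suff -> : \sum_(b < M) 2^-1 ^+ b = 2 - 2 * 2^-1 ^+ M :> R.
  by rewrite gerBl mulr_ge0 // exprn_ge0.
elim: M => [|M IH]; first by rewrite big_ord0 expr0 mulr1 subrr.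
by rewrite big_ord_recr /= IH exprS; field.
Qed.

(** n-weak separation concerns exactly [n] points, so shorter lists are padded by further terms;
    injectivity of [lam] always leaves a new one. *)
Lemma uniq_extend_range (X : eqType) (lam : nat -> X) n (s : seq X) :
  injective lam -> uniq s -> (size s <= n)%N ->
  (forall x, x \in s -> exists i, lam i = x) ->
  exists t, [/\ uniq (s ++ t), size (s ++ t) = n &
    forall x, x \in s ++ t -> exists i, lam i = x].
Proof.
move=> lamI us sn; have {sn} [k kn] : exists k, (size s + k = n)%N.
  by exists (n - size s)%N; rewrite subnKC.
elim: k s us kn => [|k IH] s us kn hs.
  by exists [::]; rewrite cats0; split => //; rewrite -kn addn0.
have [i lami] : exists i, lam i \notin s.
  apply: contrapT => /forallNP h.
  have : (size (map lam (iota 0 (size s).+1)) <= size s)%N.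
    apply: uniq_leq_size; first by rewrite map_inj_uniq // iota_uniq.
    by move=> _ /mapP[i _ ->]; apply/negPn/negP; exact: h.
  by rewrite size_map size_iota ltnn.
have [|||t] := IH (rcons s (lam i)).
- by rewrite rcons_uniq lami.
- by rewrite size_rcons addSnnS.
- by move=> x; rewrite mem_rcons inE => /predU1P[->|/hs //]; exists i.
- by rewrite cat_rcons => ht; exists (lam i :: t).
Qed.

Section SeparationToInterpolation.
Variables (R : realType) (X : topologicalType) (l : X -> X -> R[i]).
Local Notation C := R[i].
Local Notation K := (khat l).
Hypotheses (kl : is_kernel l) (q0 : Q0 l) (q2 : Q2 l).

(** Dividing by [a x] turns the combination into the normalized function at [x] plus an element of
    the span of the others, of norm at least [e]; scaling back gives the bound. *)
Lemma dist_span_le_ksq (s : seq X) (x : X) (a : X -> C) n (e : R) :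
  uniq s -> size s = n -> x \in s -> 0 < e ->
  (forall q : 'I_n.-1 -> X, injective q -> (forall k, q k <> x) ->
     (forall k, q k \in s) -> e <= dist_span l x q) ->
  e ^+ 2 * cabs (a x) ^+ 2 <= ksq K s a.
Proof.
move=> us sn xs e0 h.
have [ax0|ax0] := eqVneq (a x) 0.
  by rewrite ax0 cabs0 expr0n mulr0 ksq_ge0 //; exact: khat_kernel.
pose r := rem x s; have ur : uniq r by rewrite rem_uniq.
have sr : size r = n.-1 by rewrite size_rem // sn.
have n0 : (0 < n)%N by rewrite -sn; case: (s) xs.
pose q (k : 'I_n.-1) := nth x r k.
have qr k : q k \in r by rewrite mem_nth // sr.
have qI : injective q.
  by move=> k k' /eqP; rewrite nth_uniq ?sr // => /eqP /val_inj.
have qx k : q k <> x.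
  by move=> E; have := qr k; rewrite E mem_rem_uniq // inE eqxx.
have qs k : q k \in s by exact: mem_rem (qr k).
pose p o := if o is Some k then q k else x.
pose a' y := (a x)^-1 * a y.
have : Num.sqrt (comb_sqnorm l p (a' \o p)) >= e.
  apply: le_trans (h q qI qx qs) _; apply: ge_inf.
    by exists 0 => _ [b _ <-]; exact: sqrtr_ge0.
  exists (fun k => - a' (q k)) => //; congr (Num.sqrt (comb_sqnorm l _ _)).
  by apply/funext => -[k|] /=; rewrite ?opprK // /a' mulVf.
rewrite comb_sqnorm_ksq.
have pI : injective p.
  by move=> [k|] [k'|] //= => [/qI -> //|/qx //|/esym /qx //].
have ps : perm_eq (codom p) s.
  have up : uniq (codom p) by apply/injectiveP.
  have sub : {subset codom p <= s} by move=> _ /codomP[[k|] ->] /=.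
  have sz : (size s <= size (codom p))%N.
    by rewrite size_codom card_option card_ord prednK // sn.
  exact: uniq_perm up us (uniq_min_size up sub sz).2.
rewrite (perm_ksq _ _ ps) ksqZ cabsV exprVn => he.
have c0 : 0 < cabs (a x) ^+ 2.
  by rewrite exprn_gt0 // lt_neqAle cabs_ge0 andbT eq_sym cabs_eq0.
rewrite -ler_pdivlMr // [leRHS]mulrC.
have k0 : 0 <= (cabs (a x) ^+ 2)^-1 * ksq K s a.
  by rewrite mulr_ge0 ?invr_ge0 ?(ltW c0) // ksq_ge0 //; exact: khat_kernel.
by rewrite -[leRHS]sqr_sqrtr // ler_sqr ?nnegrE ?(ltW e0) ?sqrtr_ge0.
Qed.

(** The bounds of [dist_span_le_ksq] are averaged over the [n] points of the padded list, whence
    [e ^+ 2 / n%:R]. *)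
Lemma n_weakly_separated_riesz_lb lam n : (0 < n)%N ->
  weakly_separated l lam -> n_weakly_separated l n lam ->
  exists2 c, 0 < c & forall s, uniq s -> (size s <= n)%N ->
    (forall x, x \in s -> exists i, lam i = x) -> riesz_lb l c s.
Proof.
move=> n0 wlam [e e0 h]; have lamI := weakly_separated_inj kl q0 wlam.
have nR0 : 0 < n%:R :> R by rewrite ltr0n.
exists (e ^+ 2 / n%:R) => [|s us sn hs]; first by rewrite divr_gt0 // exprn_gt0.
have [t [ust sz hst]] := uniq_extend_range lamI us sn hs.
apply: (riesz_lb_catl ust) => a.
rewrite mulrAC ler_pdivrMr // mulr_sumr mulr_natr -sz -sumr_const_seq.
apply: ler_sum_mem => x xs.
apply: (dist_span_le_ksq a ust sz xs e0) => q qI qx qs.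
by apply: h => //; [exact: hst|move=> k; exact: hst].
Qed.

(** * Riesz bounds for a union of almost orthogonal blocks *)

Section Blocks.
Variables (s : seq X) (J : X -> nat) (n : nat) (c d : R).
Local Notation block b := [seq x <- s | J x == b].
Hypothesis block_size : forall b, (size (block b) <= n)%N.
Hypothesis block_lb : forall b, riesz_lb l c (block b).
Hypothesis d0 : 0 <= d.
Hypothesis dc : d * (2 * n%:R) <= c / 2.
Hypothesis cross : {in s &, forall x y, J x <> J y ->
  cabs (K y x) <= d * (2^-1 ^+ J x * 2^-1 ^+ J y)}.
Variable a : X -> C.

Let r x y := complex.Re (a x * (a y)^* * K y x).
Let M := (\max_(x <- s) J x).+1.
Let JM : {in s, forall x, (J x < M)%N}.
Proof. by move=> x xs; rewrite ltnS (big_rem x) //= leq_maxl. Qed.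
Let S := \sum_(x <- s) cabs (a x) ^+ 2.

Lemma block_decomposition : ksq K s a =
  \sum_(b < M) ksq K (block b) a
  + \sum_(x <- s) \sum_(y <- s | J y != J x) r x y.
Proof.
rewrite ksqE.
under eq_bigr => x _ do rewrite (bigID (fun y => J y == J x)) /=.
rewrite big_split /=; congr (_ + _); rewrite (sum_by_rank _ JM).
apply: eq_bigr => b _; rewrite ksqE; apply: eq_big_seq => x.
by rewrite mem_filter => /andP[/eqP -> _]; rewrite big_filter.
Qed.

Lemma block_weight_le : \sum_(x <- s) 2^-1 ^+ J x <= 2 * n%:R :> R.
Proof.
rewrite (sum_by_rank _ JM).
apply: (@le_trans _ _ (\sum_(b < M) n%:R * 2^-1 ^+ b)).
  apply: ler_sum => b _.
  rewrite (eq_big_seq (fun=> 2^-1 ^+ b)) => [|x]; last first.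
    by rewrite mem_filter => /andP[/eqP ->].
  by rewrite sumr_const_seq -[leLHS]mulr_natl ler_wpM2r ?exprn_ge0 // ler_nat.
by rewrite -mulr_sumr mulrC ler_wpM2r // geometric_half_le2.
Qed.

(** In each cross term [2 p q <= p^2 + q^2], and next to each square the weight of its own point is
    bounded by 1. The double sum then factors into [d * W * S], with [W] the total weight, at most
    [2 * n%:R]. *)
Lemma block_cross_le :
  `|\sum_(x <- s) \sum_(y <- s | J y != J x) r x y| <= c / 2 * S.
Proof.
pose w x : R := 2^-1 ^+ J x.
have w0 x : 0 <= w x by rewrite exprn_ge0.
have w1 x : w x <= 1 by rewrite exprn_ile1 // invf_le1 // ler1n.
have S0 : 0 <= S by apply: sumr_ge0 => x _; rewrite sqr_ge0.
apply: (@le_trans _ _ (\sum_(x <- s) \sum_(y <- s)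
    d / 2 * (cabs (a x) ^+ 2 * w y + cabs (a y) ^+ 2 * w x))).
  apply: le_trans (ler_norm_sum _ _ _) _; apply: ler_sum_mem => x xs.
  apply: le_trans (ler_norm_sum _ _ _) _; rewrite big_mkcond /=.
  apply: ler_sum_mem => y ys; case: eqP => [_|yx] /=.
    apply: mulr_ge0; first exact: divr_ge0.
    by apply: addr_ge0; apply: mulr_ge0 => //; exact: sqr_ge0.
  apply: le_trans (norm_Re_le _) _; rewrite cabs_form.
  have := cross xs ys (fun E => yx (esym E)); rewrite -/(w x) -/(w y).
  move: (cabs_ge0 (a x)) (cabs_ge0 (a y)) (w0 x) (w0 y) (w1 x) (w1 y).
  move: (cabs (a x)) (cabs (a y)) (w x) (w y) (cabs (K y x)) => p q u v k.
  move=> p0 q0' u0 v0 u1 v1 hk.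
  apply: (@le_trans _ _ (p * q * (d * (u * v)))).
    by rewrite ler_wpM2l ?mulr_ge0.
  have -> : p * q * (d * (u * v)) = d / 2 * (2 * (p * q) * (u * v)) by field.
  rewrite ler_wpM2l ?divr_ge0 //.
  apply: (@le_trans _ _ ((p ^+ 2 + q ^+ 2) * (u * v))).
    rewrite ler_wpM2r ?mulr_ge0 //; have := sqr_ge0 (p - q); nra.
  rewrite mulrDl; apply: lerD; rewrite ler_wpM2l ?sqr_ge0 //.
    by rewrite ler_piMl.
  by rewrite ler_piMr.
under eq_bigr => x _ do rewrite -mulr_sumr big_split /= -mulr_sumr -mulr_suml.
rewrite -mulr_sumr big_split /= -mulr_suml -mulr_sumr -/S.
have := block_weight_le; rewrite -/(\sum_(x <- s) w x).
set W := \sum_(x <- s) w x => hW.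
have -> : d / 2 * (S * W + S * W) = d * W * S by field.
apply: ler_wpM2r => //; apply: le_trans dc; exact: ler_wpM2l.
Qed.

Lemma block_riesz_bounds :
  c / 2 * S <= ksq K s a <= (2 * n%:R + c / 2) * S.
Proof.
have := block_cross_le; rewrite block_decomposition ler_norml => /andP[h1 h2].
have SE : S = \sum_(b < M) \sum_(x <- block b) cabs (a x) ^+ 2.
  exact: sum_by_rank.
have lo : c * S <= \sum_(b < M) ksq K (block b) a.
  by rewrite SE mulr_sumr; apply: ler_sum => b _; exact: block_lb.
have hi : \sum_(b < M) ksq K (block b) a <= 2 * n%:R * S.
  rewrite SE mulr_sumr; apply: ler_sum => b _; rewrite ksqE.
  set t := block b; set T := \sum_(x <- t) cabs (a x) ^+ 2.
  have T0 : 0 <= T by apply: sumr_ge0 => x _; rewrite sqr_ge0.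
  (* Entries of [khat] have modulus at most 2, and [2 p q <= p^2 + q^2]. *)
  apply: (@le_trans _ _ (\sum_(x <- t) \sum_(y <- t)
      (cabs (a x) ^+ 2 + cabs (a y) ^+ 2))).
    apply: ler_sum => x _; apply: ler_sum => y _.
    apply: le_trans (ler_norm _) _; apply: le_trans (norm_Re_le _) _.
    rewrite cabs_form; have := cabs_khat_le2 kl q0 x y.
    move: (cabs_ge0 (a x)) (cabs_ge0 (a y)).
    move: (cabs (a x)) (cabs (a y)) (cabs (K y x)) => p q k p0 q0' hk.
    apply: (@le_trans _ _ (p * q * 2)); first by rewrite ler_wpM2l ?mulr_ge0.
    have := sqr_ge0 (p - q); nra.
  under eq_bigr => x _ do rewrite big_split /= sumr_const_seq.
  rewrite big_split /= sumr_const_seq sumrMnl -/T -mulrnDl.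
  have -> : (T + T) *+ size t = 2 * (size t)%:R * T.
    by rewrite -[LHS]mulr_natl; ring.
  by rewrite ler_wpM2r // ler_wpM2l // ler_nat; exact: block_size.
by apply/andP; split; lra.
Qed.

End Blocks.

Lemma separation_interpolating (n : nat) (lam : nat -> X)
    (mu : 'I_n -> nat -> X) :
  (0 < n)%N -> weakly_separated l lam -> n_weakly_separated l n lam ->
  (forall x, (exists i, lam i = x) <-> (exists k j, mu k j = x)) ->
  (forall k, knorm l (mu k j) @[j --> \oo] --> +oo) ->
  exists m : nat -> nat, {homo m : a b / (a < b)%N} /\
    interpolating l [set x | exists k j, mu k (m j) = x].
Proof.
move=> n0 wlam nlam lamu muy.
have [c c0 hc] := n_weakly_separated_riesz_lb n0 wlam nlam.
have nR0 : 0 < n%:R :> R by rewrite ltr0n.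
pose d := c / 2 / (2 * n%:R).
have d0 : 0 < d by rewrite !divr_gt0 // mulr_gt0.
have half0 : 0 < 2^-1 :> R by rewrite invr_gt0.
have half1 : 2^-1 <= 1 :> R by rewrite invf_le1 // ler1n.
(* Tolerance between a new block and all those of rank up to [M]. The block number [t.+1] is at most
   [(m t).+1], so with [M = m t] this is below the product of weights required by the block
   estimate. *)
pose bd M : R := d * (2^-1 ^+ M.+1 * 2^-1 ^+ M.+1).
have next M : exists N, (M < N)%N /\ forall k k' i, (i <= M)%N ->
    cabs (K (mu k N) (mu k' i)) <= bd M.
  have [N hN] : exists N, forall j, (N <= j)%N ->
      forall z, z \in allpairs (fun k ki => (k, ki)) (enum 'I_n)
        (allpairs (fun k i => (k, i)) (enum 'I_n) (iota 0 M.+1)) ->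
      cabs (K (mu z.1 j) (mu z.2.1 z.2.2)) <= bd M.
    apply: finite_uniform_rank => z _; apply: khat_vanish => //.
    by rewrite /bd mulr_gt0 // mulr_gt0 // exprn_gt0.
  exists (maxn N M.+1); split => [|k k' i iM]; first exact: leq_maxr.
  apply: (hN _ (leq_maxl _ _) (k, (k', i))).
  by rewrite !allpairs_f // ?mem_enum // mem_iota.
have {next} [N hN] := choice next.
(* Each new rank is almost orthogonal to every rank up to the previous one, which covers all blocks
   already selected. *)
pose m := fix m j := if j is j'.+1 then N (m j') else 0%N.
have mh : {homo m : a b / (a < b)%N}.
  by apply: homo_ltn => [? ? ?|j]; [exact: ltn_trans|exact: (hN _).1].
have mle : {homo m : a b / (a <= b)%N}.
  by move=> i j; rewrite leq_eqVlt => /predU1P[-> //|/mh /ltnW].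
exists m; split => //; set U := [set x | _].
(* A point may occur in several blocks; choice assigns it to one, whose number is [J x]. Points
   outside [U] get a dummy code. *)
have codeU x : exists kj : 'I_n * nat, U x -> mu kj.1 (m kj.2) = x.
  have [[k [j xE]]|nU] := pselect (U x); first by exists (k, j).
  by exists (Ordinal n0, 0%N) => /nU.
have [kJ hkJ] := choice codeU.
pose J x := (kJ x).2.
exists (c / 2), (2 * n%:R + c / 2); split; first by rewrite divr_gt0.
split; first by rewrite addr_gt0 ?divr_gt0 ?mulr_gt0.
move=> M p a pI pU; have [b ->] := injective_factor a pI.
rewrite comb_sqnorm_ksq.
have -> : \sum_(k < M) cabs ((b \o p) k) ^+ 2 =
    \sum_(x <- codom p) cabs (b x) ^+ 2.
  by rewrite big_image.
have sU x : x \in codom p -> U x by move=> /codomP[k ->].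
have us : uniq (codom p) by apply/injectiveP.
have lt_cross x y : x \in codom p -> y \in codom p -> (J x < J y)%N ->
    cabs (K y x) <= d * (2^-1 ^+ J x * 2^-1 ^+ J y).
  move=> /sU Ux /sU Uy; rewrite -{2}(hkJ x Ux) -{2}(hkJ y Uy) -/(J x) -/(J y).
  case: (J y) => // t; rewrite ltnS => xt.
  apply: le_trans ((hN (m t)).2 _ _ _ (mle _ _ xt)) _.
  rewrite ler_wpM2l ?(ltW d0) //.
  have tm : (t.+1 <= (m t).+1)%N by rewrite ltnS leq_homo_nat.
  apply: ler_pM; rewrite ?exprn_ge0 ?(ltW half0) //; apply: ler_wiXn2l => //.
    by apply: leq_trans tm; exact: leqW.
(* Points with the same [J] are distinguished by their first code in ['I_n]. *)
have size_block t : (size [seq x <- codom p | J x == t] <= n)%N.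
  rewrite -(size_map (fun x => (kJ x).1)) -[leqRHS](size_enum_ord n).
  apply: uniq_leq_size => [|k _]; last by rewrite mem_enum.
  rewrite map_inj_in_uniq ?filter_uniq // => x y.
  rewrite !mem_filter => /andP[/eqP xt xs] /andP[/eqP yt ys] kxy.
  rewrite -(hkJ x (sU x xs)) -(hkJ y (sU y ys)) kxy.
  by rewrite -[(kJ x).2]/(J x) -[(kJ y).2]/(J y) xt yt.
apply/andP; apply: (block_riesz_bounds (J := J) (d := d)) => //.
- move=> t; apply: hc; first by rewrite filter_uniq.
    exact: size_block.
  move=> x; rewrite mem_filter => /andP[_ /sU [k [j xE]]].
  by apply/lamu; exists k, (m j).
- exact: ltW.
- by rewrite /d divfK // mulf_neq0 // ?pnatr_eq0 // -lt0n.
- move=> x y xs ys; case: (ltngtP (J x) (J y)) => // [xy _|yx _].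
    exact: lt_cross.
  by rewrite cabs_khat_sym // [_ ^+ J x * _]mulrC; exact: lt_cross.
Qed.

End SeparationToInterpolation.

Theorem theorem5p13 (R : realType) (X : topologicalType) (l : X -> X -> R[i]) :
  is_kernel l -> Q0 l -> Q1 l -> Q2 l -> Q3 l ->
  (automatic_separation l <-> cond_ii l).
Proof.
move=> kl q0 q1 q2 q3; split=> [auto n n3 lam wlam mu|cii lam wlam n n3].
  apply: separation_interpolating => //; first exact: leq_trans n3.
  exact: auto.
by apply: cond_ii_n_weakly_separated => //; exact: leq_trans n3.
Qed.
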